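(* Let $k,n$ be integers with $3\le k\le n$, and define $$c_{rj}=(j+2)(k-1-r)+n-k+2\qquad (r=1,\ldots,k-1;\ j=0,\ldots,n-k).$$ Suppose a stick is broken at random at $n-1$ points to form $n$ pieces. Then the probability $\overline{Q}(k,n)$ that a $k$-gon cannot be formed for at least one choice of $k$ pieces out of the $n$ pieces is $$\overline{Q}(k,n)=\frac{n!}{(n-k+2)!}\sum_{j=0}^{n-k}(-1)^j\binom{n-k+1}{j+1}\Bigl(\prod_{r=1}^{k-2}c_{rj}\Bigr)^{-1}.$$
   Context: The stick is taken, without loss of generality, to have length 1. ''Broken at random at $n-1$ points'' means that the $n-1$ breaking points are independent and uniformly distributed on the stick; the $n$ pieces are the resulting consecutive segments. A set of $k$ pieces forms a $k$-gon if and only if the length of the longest of these pieces is less than the sum of the lengths of the other $k-1$ pieces (ties occur with probability zero). *)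

(* Defs.v *)
From HB Require Import structures.
From mathcomp Require Import all_boot all_order all_algebra.
From mathcomp Require Import all_classical all_reals all_analysis.

Set Implicit Arguments.
Unset Strict Implicit.
Unset Printing Implicit Defensive.

Import Order.TTheory GRing.Theory Num.Theory.

Local Open Scope classical_set_scope.
Local Open Scope ring_scope.

Definition mutually_independent d (T : measurableType d) (R : realType)
    (P : probability T R) (I : finType) (X : I -> {RV P >-> R}) : Prop :=
  forall (J : {set I}) (B : I -> set R),
    (forall i, i \in J -> measurable (B i)) ->
    P (\bigcap_(i in [set` J]) (X i @^-1` B i)) =
      (\prod_(i in J) P (X i @^-1` B i))%E.

Definition uniform01 d (T : measurableType d) (R : realType)
    (P : probability T R) (X : {RV P >-> R}) : Prop :=
  forall B : set R, measurable B ->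
    distribution P X B = uniform_prob (@ltr01 R) B.

(* The end points of the pieces of the stick [0, 1] broken at the points u i,
   from left to right. *)
Definition nodes (R : realType) (m : nat) (u : 'I_m -> R) : seq R :=
  0 :: rcons (sort <=%R [seq u i | i <- enum 'I_m]) 1.

Definition piece (R : realType) (n : nat) (u : 'I_n.-1 -> R) (i : 'I_n) : R :=
  (nodes u)`_i.+1 - (nodes u)`_i.

(* The index i is that of a longest piece of A; if several pieces of A are
   longest, the condition does not depend on which one is chosen. *)
Definition forms_polygon (R : realType) (n : nat) (x : 'I_n -> R)
    (A : {set 'I_n}) : Prop :=
  exists i : 'I_n, [/\ i \in A, forall j : 'I_n, j \in A -> x j <= x i
    & x i < \sum_(j in A | j != i) x j].

(* The subtractions do not truncate when r < k <= n. *)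
Definition c (k n r j : nat) : nat :=
  ((j + 2) * (k - 1 - r) + n - k + 2)%N.

(* Main.v *)
Require Import Defs.
From HB Require Import structures.
From mathcomp Require Import all_boot all_order all_algebra.
From mathcomp Require Import fingroup perm.
From mathcomp Require Import all_classical all_reals all_analysis.
From mathcomp Require Import measurable_realfun.
From mathcomp Require Import zify ring lra.

(** Write y_1 <= ... <= y_n for the pieces in increasing order.  A set of k
    pieces whose longest piece is y_i, where i >= k, is hardest to close when
    the other ones are y_1, ..., y_(k-1), and then i = n is the worst case.
    Hence every set of k pieces forms a k-gon if and only if y_n < y_1 + ... + y_(k-1)
    (some_not_polygon_sorted).

    This condition is invariant under scaling, so the stick may be given a
    random length.  For a gamma distributed length, of density
    g^(n-1) exp(-g) / (n-1)!, independent of the breaking points, the n pieces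
    become independent exponential variables; equivalently, the numbers
    u_i = exp(- piece_i) become independent and uniform on [0, 1]
    (exp_pieces_law).  Indeed the n pieces of the stick of length 1 exceed
    a_1, ..., a_n >= 0 with probability (1 - a_1 - ... - a_n)_+^(n-1)
    (cube_pieces_gt), and integrating this against the gamma density gives the
    survival function exp(- a_1 - ... - a_n) (integral_gamma); a law is
    determined by such values (orthant_unique).

    What remains is the volume of a subset of the cube [0, 1]^n.  On the part
    where 1 > v_1 > ... > v_n > 0 are the u_i in decreasing order, the k-gons
    all exist if and only if v_1 ... v_(k-1) < v_n.  By symmetry this event has
    n! times the volume of the set of such points v, which is found by
    integrating over one coordinate after the other (cube_descending_prod).
    Put N = n - k + 1.  The last N coordinates lie between
    p = v_1 ... v_(k-1) and v_(k-1), so they contribute (v_(k-1) - p)^N / N!.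
    By the binomial formula this is a combination of the monomials
    p^l v_(k-1)^(N-l), and each of the k - 1 integrations that follow turns a
    monomial into a monomial and divides it by an exponent: the exponents met
    are N + 1 + r (l + 1) for r = 0, ..., k - 2.  With l = j + 1 these are the
    numbers N + 1 and c_(k-1-r, j).  Multiplied by n!, the term l = 0 is 1, so it
    disappears when passing to the complementary event, and what is left is the
    formula (descending_vol_formula). *)

Set Implicit Arguments.
Unset Strict Implicit.
Unset Printing Implicit Defensive.

Import Order.TTheory GRing.Theory Num.Theory.
Import numFieldNormedType.Exports.

Local Open Scope classical_set_scope.
Local Open Scope ring_scope.

(** * Images of probability measures *)

Section law.
Context d d' {T : measurableType d} {T' : measurableType d'} {R : realType}.

(** The map comes with a proof of measurability instead of a bundled structure,
    so that it can be given by an explicit formula at the point of use. *)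
Definition law (P : probability T R) (f : T -> T') (mf : measurable_fun setT f)
  : probability T' R :=
  distribution P (HB.pack_for {mfun T >-> T'} f
                    (isMeasurableFun.Build _ _ _ _ f mf)).

Lemma lawE (P : probability T R) (f : T -> T') (mf : measurable_fun setT f) A :
  law P mf A = P (f @^-1` A).
Proof. by []. Qed.

End law.

Section events.
Context {R : realType}.

Lemma measurable_setb d (T : measurableType d) (b : T -> bool) :
  measurable_fun setT b -> measurable [set w | b w].
Proof.
move=> mb; rewrite (_ : [set w | b w] = setT `&` b @^-1` [set true]); first exact: mb.
by rewrite setTI; apply/seteqP; split.
Qed.

Lemma probability_setI1 d (T : measurableType d) (P : probability T R) (A C : set T) :
  measurable A -> measurable C -> P C = 1%E -> P (A `&` C) = P A.
Proof.
move=> mA mC PC.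
have PnC : P (~` C) = 0%E by rewrite probability_setC// PC subee.
rewrite -[in RHS](setIT A) -(setUv C) setIUr measureU//.
- rewrite [X in _ = (_ + X)%E](_ : _ = 0%E) ?adde0//.
  apply/eqP; rewrite eq_le measure_ge0 andbT -PnC le_measure ?inE//.
  - by apply: measurableI => //; exact: measurableC.
  - exact: measurableC.
- exact: measurableI.
- by apply: measurableI => //; exact: measurableC.
- by rewrite setIACA setICr setI0.
Qed.

End events.

(** * The uniform measure on the unit cube *)

Section cube.
Context {R : realType}.

Let idTR : measurableTypeR R -> R := idfun.
#[local] HB.instance Definition _ :=
  @isMeasurableFun.Build _ _ _ _ idTR (@measurable_id _ _ setT).

(** The uniform distribution as a measure on the real numbers with the
    measurable structure that tuples and products of reals inherit. *)
Definition unif01 : probability R R := distribution (uniform_prob (@ltr01 R)) idTR.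

Lemma unif01E (A : set R) : unif01 A = uniform_prob (@ltr01 R) A.
Proof. by []. Qed.

Lemma integral_unif01 (f : R -> \bar R) :
  measurable_fun setT f -> (forall x, 0 <= f x)%E ->
  (\int[unif01]_x f x = \int[lebesgue_measure]_(x in `[0%R, 1%R]) f x)%E.
Proof.
move=> mf f0.
rewrite ge0_integral_distribution// integral_uniform//.
by rewrite subr0 invr1 mul1e.
Qed.

Lemma unif01_itvNyo (b : R) : unif01 `]-oo, b[%classic = (Num.min 1 (Num.max 0 b))%:E.
Proof.
rewrite unif01E /uniform_prob integral_uniform_pdf.
have mI : measurable (`]-oo, b[%classic `&` `[0, 1]%classic : set R) by exact: measurableI.
rewrite (eq_integral (fun=> 1%E)) => [|x]; last first.
  by rewrite inE => -[_ /=]; rewrite in_itv/= /uniform_pdf => ->; rewrite subr0 invr1.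
rewrite integral_cst// mul1e.
have [b0|b0] := leP b 0.
  rewrite min_r ?ler01// (_ : _ `&` _ = set0) ?measure0//.
  apply/seteqP; split => x //= []; rewrite !in_itv/= => xb /andP[x0 _].
  by have := le_lt_trans x0 xb; rewrite ltNge b0.
have [b1|b1] := leP b 1.
  transitivity (lebesgue_measure ([set` `[0, b[%R] : set R)); last first.
    by rewrite lebesgue_measure_itv/= lte_fin b0 -EFinD subr0.
  congr lebesgue_measure; apply/seteqP; split => x /=; rewrite !in_itv/=.
    by move=> [-> /andP[-> _]].
  by move=> /andP[x0 xb]; rewrite x0 xb (le_trans (ltW xb) b1).
transitivity (lebesgue_measure ([set` `[0, 1]%R] : set R)); last first.
  by rewrite lebesgue_measure_itv/= lte_fin ltr01 -EFinD subr0.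
congr lebesgue_measure; apply/seteqP; split => x /=; rewrite !in_itv/=.
  by move=> [].
by move=> /andP[x0 x1]; rewrite x0 x1 (le_lt_trans x1 b1).
Qed.

Definition consr n (xs : R * n.-tuple R) : n.+1.-tuple R :=
  [the n.+1.-tuple R of xs.1 :: xs.2].

Lemma measurable_consr n : measurable_fun setT (@consr n).
Proof. by apply: measurable_cons; [exact: measurable_fst|exact: measurable_snd]. Qed.

(** Adding coordinates at the head makes volumes computable by slicing along
    the first coordinate, see cubeSE and cube_slice. *)
Fixpoint cube n : probability (n.-tuple R) R :=
  match n with
  | 0 => dirac [tuple]
  | n'.+1 => law (unif01 \x cube n')%E (@measurable_consr n')
  end.

Lemma cube0E (A : set (0.-tuple R)) (b : bool) : (A [tuple] <-> b) ->
  cube 0 A = (b%:R)%:E.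
Proof.
rewrite [LHS]diracE; case: b => -[A1 A2]; first by rewrite mem_set//; exact: A2.
by rewrite memNset// => /A1.
Qed.

Lemma cubeSE n (A : set (n.+1.-tuple R)) :
  cube n.+1 A = (\int[unif01]_x cube n [set t | A (consr (x, t))])%E.
Proof.
transitivity (product_measure1 unif01 (cube n) (@consr n @^-1` A)) => //.
apply: eq_integral => x _ /=; congr (cube n _).
by apply/seteqP; split => t /=; rewrite /xsection /= inE.
Qed.

Definition orthant n (b : 'I_n -> R) : set (n.-tuple R) :=
  [set t | forall i, tnth t i < b i].

Lemma orthant_setI n (b c : 'I_n -> R) :
  orthant b `&` orthant c = orthant (fun i => Num.min (b i) (c i)).
Proof.
apply/seteqP; split => t /=.
  by move=> [K1 K2] i; rewrite lt_min K1 K2.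
by move=> K; split => i; have := K i; rewrite lt_min => /andP[].
Qed.

Lemma measurable_orthant n (b : 'I_n -> R) : measurable (orthant b).
Proof.
rewrite [X in measurable X](_ : _ =
  \bigcap_(i in [set: 'I_n]) ((fun t : n.-tuple R => tnth t i) @^-1` `]-oo, b i[%classic)); last first.
  apply/seteqP; split => t /=.
    by move=> H i _ /=; rewrite in_itv; exact: H.
  by move=> H i; have := H i I; rewrite /= in_itv.
apply: fin_bigcap_measurable; first exact: finite_finset.
move=> i _; rewrite -[X in measurable X]setTI; exact: measurable_tnth.
Qed.

Lemma cube_orthant n (b : 'I_n -> R) :
  cube n (orthant b) = (\prod_i unif01 `]-oo, b i[%classic)%E.
Proof.
elim: n b => [|n IH] b.
  by rewrite big_ord0 [LHS]diracE mem_set// => -[].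
rewrite big_ord_recl -(IH (fun i => b (lift ord0 i))).
transitivity (product_measure1 unif01 (cube n) (@consr n @^-1` orthant b)) => //.
rewrite -product_measure1E//.
  congr product_measure1.
  apply/seteqP; split => -[x t] /=.
    move=> H; split => /=.
      by have := H ord0; rewrite in_itv.
    by move=> i; have := H (lift ord0 i); rewrite tnthS.
  move=> [] /=; rewrite in_itv/= => H1 H2 i.
  by case: (unliftP ord0 i) => [j|] ->//; rewrite tnthS; exact: H2.
exact: measurable_orthant.
Qed.

(* Simplification would replace cube n.+1 by the product measure behind it. *)
#[global] Opaque cube.

Lemma tuple_upper_bound n (t : n.-tuple R) : exists k : nat, forall i, tnth t i < k%:R.
Proof.
exists (\sum_i (Num.bound (tnth t i)))%N => i.
have [t0|t0] := leP 0 (tnth t i); last by rewrite (lt_le_trans t0).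
by rewrite (lt_le_trans (archi_boundP t0))// ler_nat (bigD1 i)//= leq_addr.
Qed.

(** Orthants are stable under intersection and generate the measurable sets of
    tuples, since a half-space orthogonal to an axis is an increasing union of
    orthants. *)
Lemma orthant_unique n (m1 m2 : probability (n.-tuple R) R) :
  (forall b : 'I_n -> R, m1 (orthant b) = m2 (orthant b)) ->
  forall A, measurable A -> m1 A = m2 A.
Proof.
move=> H A mA.
pose G : set (set (n.-tuple R)) := range (@orthant n).
apply: (@measure_unique _ _ _ G (fun k => orthant (fun=> k%:R))) => //.
- apply/seteqP; split; last first.
    apply: smallest_sub; first exact: sigma_algebra_measurable.
    by move=> _ [b _ <-]; exact: measurable_orthant.
  apply: smallest_sub; first exact: smallest_sigma_algebra.
  rewrite -bigcup_seq => /= B [i _ /=] [C mC <-].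
  have mi : measurable_fun setT (fun t : g_sigma_algebraType G => tnth t i).
    apply: (measurability _ (RGenInftyO.measurableE R)).
    move=> _ [_ [x ->] <-].
    rewrite (_ : _ `&` _ =
        \bigcup_k orthant (fun j => if j == i then x else k%:R)).
      apply: bigcupT_measurable => k; apply: sub_sigma_algebra.
      by exists (fun j => if j == i then x else k%:R).
    apply/seteqP; split => t /=.
      move=> [_]; rewrite in_itv/= => tx.
      have [k tk] := tuple_upper_bound t; exists k => // j /=.
      by case: eqP => [->|].
    by move=> [k _ /(_ i)]; rewrite eqxx in_itv.
  exact: mi.
- move=> _ _ [b _ <-] [c _ <-].
  by rewrite orthant_setI; exists (fun i => Num.min (b i) (c i)).
- by move=> k; exists (fun=> k%:R).
- apply/seteqP; split => // t _.
  by have [k tk] := tuple_upper_bound t; exists k.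
- by move=> _ [b _ <-]; exact: H.
- move=> k; rewrite (le_lt_trans (probability_le1 _ _)) ?ltry//.
  exact: measurable_orthant.
Qed.

(** A law carried by ]0, +oo[^n needs to be known only on the orthants with
    vertex in ]0, 1]^n: an orthant with a vertex outside ]0, +oo[^n is null, and
    the orthant with vertex (1, ..., 1) has full measure, so that the
    coordinates of a vertex can be truncated at 1. *)
Lemma cube_of_orthants n (nu : probability (n.-tuple R) R) :
  nu [set t | forall i, 0 < tnth t i] = 1%E ->
  (forall b : 'I_n -> R, (forall i, 0 < b i <= 1) ->
     nu (orthant b) = (\prod_i b i)%:E) ->
  forall A, measurable A -> nu A = cube n A.
Proof.
move=> nupos nub; apply: orthant_unique => b.
rewrite cube_orthant.
under eq_bigr do rewrite unif01_itvNyo.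
rewrite prodEFin.
have [/existsP[i bi]|] := boolP [exists i, b i <= 0].
  rewrite (bigD1 i)//= max_l// min_r// mul0r.
  rewrite -(@probability_setI1 _ _ _ nu _ _ (measurable_orthant b) _ nupos).
    rewrite (_ : _ `&` _ = set0) ?measure0//.
    apply/seteqP; split => t //= -[/(_ i) ti /(_ i)].
    by rewrite ltNge (le_trans (ltW ti) bi).
  rewrite (_ : [set t | _] = \bigcap_(i in [set: 'I_n]) [set t : n.-tuple R | 0 < tnth t i]).
    apply: fin_bigcap_measurable; first exact: finite_finset.
    move=> j _; apply: measurable_setb; apply: measurable_fun_ltr => //.
    exact: measurable_tnth.
  by apply/seteqP; split => t /= tp j => [_|]; exact: tp.
rewrite negb_exists => /forallP b0.
have {}b0 i : 0 < b i by rewrite ltNge b0.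
rewrite -(@probability_setI1 _ _ _ nu _ _ (measurable_orthant b) (measurable_orthant (fun=> 1))).
  rewrite orthant_setI nub => [|i].
    congr (_%:E); apply: eq_bigr => i _.
    by rewrite max_r ?(ltW (b0 i))// minC.
  by rewrite lt_min b0 ltr01 ge_min lexx orbT.
rewrite nub => [|i]; last by rewrite ltr01 lexx.
by rewrite big1.
Qed.

Definition perm_tuple n (s : 'S_n) (t : n.-tuple R) : n.-tuple R :=
  [tuple tnth t (s i) | i < n].

Lemma measurable_perm_tuple n (s : 'S_n) : measurable_fun setT (perm_tuple s).
Proof.
apply/measurable_fun_tnthP => i.
rewrite (_ : _ \o _ = fun t => tnth t (s i)); first exact: measurable_tnth.
by apply/funext => t /=; rewrite tnth_mktuple.
Qed.

Lemma cube_perm n (s : 'S_n) (A : set (n.-tuple R)) : measurable A ->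
  cube n (perm_tuple s @^-1` A) = cube n A.
Proof.
move=> mA; rewrite -(lawE _ (measurable_perm_tuple s)).
apply: orthant_unique => // b; rewrite lawE.
rewrite (_ : _ @^-1` _ = orthant (fun i => b ((s^-1)%g i))).
  rewrite !cube_orthant [RHS](reindex_inj (@perm_inj _ (s^-1)%g))/=.
  by [].
apply/seteqP; split => t /= tb i.
  by have := tb ((s^-1)%g i); rewrite tnth_mktuple permKV.
by have := tb (s i); rewrite tnth_mktuple permK.
Qed.

End cube.

Section cube_theory.
Context {R : realType}.

Lemma law_independent_uniform d (T : measurableType d) (P : probability T R) m
    (X : 'I_m -> {RV P >-> R}) :
  (forall i, uniform01 (X i)) -> mutually_independent X ->
  forall A : set (m.-tuple R), measurable A ->
  P [set w | A [tuple X i w | i < m]] = cube m A.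
Proof.
move=> X_unif X_indep A mA.
have mX : measurable_fun setT (fun w => [tuple X i w | i < m]).
  apply/measurable_fun_tnthP => i.
  rewrite (_ : _ \o _ = X i)//.
  by apply/funext => w /=; rewrite tnth_mktuple.
rewrite -[LHS]/(law P mX A).
apply: orthant_unique => // b.
rewrite cube_orthant lawE.
rewrite (_ : _ @^-1` _ =
    \bigcap_(i in [set` [set: 'I_m]%SET]) (X i @^-1` `]-oo, b i[%classic)).
  rewrite X_indep//.
  apply: eq_big => [i|i _]; first by rewrite finset.in_setT.
  by have := X_unif i _ (measurable_itv `]-oo, b i[).
apply/seteqP; split => w /=.
  by move=> H i _ /=; have := H i; rewrite tnth_mktuple in_itv.
move=> H i; have := H i; rewrite tnth_mktuple /= in_itv /=; apply.
by rewrite finset.in_setT.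
Qed.

(** A tuple has at most one rearrangement that is sorted for a strict order, so
    the n! sets are pairwise disjoint, and they have the same volume by
    cube_perm. *)
Lemma cube_sorted_perms n (r : rel R) (D : set (n.-tuple R)) :
  irreflexive r -> transitive r -> measurable D ->
  (forall t, D t -> sorted r t) ->
  cube n (\bigcup_(s in [set: 'S_n]) (perm_tuple s @^-1` D)) =
  ((n`!)%:R%:E * cube n D)%E.
Proof.
move=> rI rT mD Dr.
have mp s : measurable (perm_tuple s @^-1` D).
  by rewrite -[X in measurable X]setTI; exact: measurable_perm_tuple.
rewrite measure_fin_bigcup//; first last.
- move=> s s' _ _ [t [/= Ds Ds']].
  have sub (a b : 'S_n) : {subset perm_tuple a t <= perm_tuple b t}.
    move=> x /tnthP[i ->]; rewrite tnth_mktuple; apply/tnthP.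
    by exists ((b^-1)%g (a i)); rewrite tnth_mktuple permKV.
  have e : perm_tuple s t = perm_tuple s' t.
    apply: val_inj; apply: (irr_sorted_eq rT rI); [exact: Dr|exact: Dr|].
    by move=> x; apply/idP/idP; exact: sub.
  have /tuple_uniqP us : uniq (perm_tuple s t) by exact: (sorted_uniq rT rI (Dr _ Ds)).
  apply/permP => i.
  have := congr1 (fun u => tnth u i) e; rewrite !tnth_mktuple => e'.
  apply/esym; apply: (canRL (permKV s)); apply: us.
  by rewrite !tnth_mktuple permKV.
- exact: finite_finset.
- rewrite (eq_fsbigr (fun=> cube n D)); last by move=> s _; exact: cube_perm.
  rewrite (fsbigE (index_enum {perm 'I_n}))//; last 2 first.
  + exact: index_enum_uniq.
  + by move=> s _; rewrite mem_index_enum.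
  rewrite (eq_bigl xpredT) => [|s]; last by rewrite in_setT.
  rewrite -[cube n D]fineK ?fin_num_measure//.
  by rewrite sumEFin sumr_const card_Sn -EFinM -mulr_natl mulr1 mulr_natl.
Qed.

(** Fubini and the fundamental theorem of calculus in the only form used in
    what follows: the volume of the slices is a polynomial on an interval, given
    through a primitive, and zero off this interval.  The two end
    points form a null set. *)
Lemma cube_slice n (A : set (n.+1.-tuple R)) (q : {poly R}) (a b : R) :
  measurable A -> 0 <= a -> a <= b -> b <= 1 ->
  (forall x, a < x < b -> cube n [set t | A (consr (x, t))] = (q^`().[x])%:E) ->
  (forall x, 0 <= x <= 1 -> ~~ (a <= x <= b) ->
     cube n [set t | A (consr (x, t))] = 0%E) ->
  cube n.+1 A = (q.[b] - q.[a])%:E.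
Proof.
move=> mA a0 ab b1 H1 H2.
rewrite cubeSE.
set f := fun x => cube n [set t | A (consr (x, t))].
have mf : measurable_fun setT f.
  have := @measurable_fun_xsection _ _ R (n.-tuple R) R (cube n) (@consr R n @^-1` A).
  rewrite (_ : _ \o _ = f).
    by apply; rewrite -[X in measurable X]setTI; exact: measurable_consr.
  apply/funext => x; rewrite /f /=; congr (cube n _).
  by apply/seteqP; split => t /=; rewrite /xsection /= inE.
rewrite integral_unif01//.
transitivity (\int[lebesgue_measure]_(x in `[a, b]) f x)%E.
  rewrite [LHS]integral_mkcond [RHS]integral_mkcond.
  apply: eq_integral => x _; rewrite !patchE !mem_setE.
  case: ifPn => [x01|x01]; case: ifPn => [xab|xab] //.
    by apply: H2; [move: x01|move: xab]; rewrite in_itv.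
  case/negP: x01; move: xab; rewrite !in_itv/= => /andP[ax xb].
  by rewrite (le_trans a0 ax) (le_trans xb b1).
move: ab; rewrite le_eqVlt => /predU1P[ab|ab].
  by rewrite ab set_itv1 integral_set1 subrr.
rewrite -integral_itv_bndo_bndc; last exact: measurable_funTS.
rewrite -integral_itv_obnd_cbnd; last exact: measurable_funTS.
transitivity (\int[lebesgue_measure]_(x in `]a, b[) (q^`().[x])%:E)%E.
  by apply: eq_integral => x; rewrite inE /= in_itv => /H1.
have mq : measurable_fun setT (fun x : R => (q^`().[x])%:E).
  apply/measurable_EFinP; apply: continuous_measurable_fun.
  exact: continuous_horner.
rewrite integral_itv_obnd_cbnd; last exact: measurable_funTS.
rewrite integral_itv_bndo_bndc; last exact: measurable_funTS.
rewrite (@continuous_FTC2 _ _ (horner q))//.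
- by apply: continuous_subspaceT => x; exact: continuous_horner.
- split => //.
  + by apply: cvg_at_right_filter; exact: continuous_horner.
  + by apply: cvg_at_left_filter; exact: continuous_horner.
- by move=> x _; rewrite derive1E derive_val.
Qed.

End cube_theory.

(** * Volumes of sets of ordered points *)

Section ordered_points.
Context {R : realType}.

Lemma measurable_tuple_head d (T : measurableType d) n (g : T -> n.+1.-tuple R) :
  measurable_fun setT g -> measurable_fun setT (fun w => thead (g w)).
Proof. by move=> mg; exact: (measurableT_comp (measurable_tnth ord0) mg). Qed.

Lemma measurable_tuple_behead d (T : measurableType d) n (g : T -> n.+1.-tuple R) :
  measurable_fun setT g -> measurable_fun setT (fun w => [tuple of behead (g w)] : n.-tuple R).
Proof.
move=> mg; pose f := fun x : n.+1.-tuple R => [tuple of behead x] : n.-tuple R.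
by apply: (@measurableT_comp _ _ _ _ _ _ f) => //; exact: measurable_behead.
Qed.

(** The divided powers (X - c)^n / n! form a sequence of successive primitives. *)
Lemma deriv_exp_div (c : R) n :
  ((n.+1`!)%:R^-1 *: (('X - c%:P) ^+ n.+1))^`() = (n`!)%:R^-1 *: ('X - c%:P) ^+ n.
Proof.
rewrite derivZ deriv_exp derivB derivX derivC subr0 mul1r /=.
rewrite -[_ ^+ n *+ _]scaler_nat scalerA; congr (_ *: _).
by rewrite factS natrM invfM mulrAC mulVf ?mul1r// pnatr_eq0.
Qed.

(** This encodes lower bounds on successive gaps (spacedP) by recursion on the
    points, so that fixing the first point leaves a condition of the same kind. *)
Fixpoint spaced (x : R) (a s : seq R) : bool :=
  if s is y :: s' then (x + head 0 a < y) && spaced y (behead a) s'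
  else x + head 0 a < 1.

Lemma measurable_spaced d (T : measurableType d) n a (f : T -> R) (g : T -> n.-tuple R) :
  measurable_fun setT f -> measurable_fun setT g ->
  measurable_fun setT (fun w => spaced (f w) a (g w)).
Proof.
elim: n a f g => [|n IH] a f g mf mg.
  under eq_fun do rewrite (tuple0 (g _)) /=.
  by apply: measurable_fun_ltr => //; apply: measurable_funD.
under eq_fun do rewrite (tuple_eta (g _)) /=.
apply: measurable_and.
  apply: measurable_fun_ltr; first exact: measurable_funD.
  exact: measurable_tuple_head.
apply: (IH _ _ (fun w => [tuple of behead (g w)] : n.-tuple R)).
  exact: measurable_tuple_head.
exact: measurable_tuple_behead.
Qed.

(** Removing the prescribed gaps leaves n increasing points in an interval of
    length 1 - x - (sum of a), hence the simplex volume. *)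
Lemma cube_spaced n (a : seq R) (x : R) : size a = n.+1 ->
  all (fun z => 0 <= z) a -> 0 <= x ->
  cube n [set t : n.-tuple R | spaced x a t] =
  (if x + \sum_(z <- a) z < 1 then (1 - (x + \sum_(z <- a) z)) ^+ n / (n`!)%:R else 0)%:E.
Proof.
elim: n a x => [|n IH] [//|a0 a] x /= [sa] /andP[a00 a_ge0] x0.
  rewrite (@cube0E _ _ (x + a0 < 1))//.
  case: a sa a_ge0 => //= _ _; rewrite big_seq1.
  by case: ifP => _ //; rewrite expr0 fact0 divr1.
rewrite big_cons; set S := \sum_(z <- a) z.
have S0 : 0 <= S by rewrite /S big_seq; apply: sumr_ge0 => z za; exact: (allP a_ge0).
have mA : measurable [set t : n.+1.-tuple R | spaced x (a0 :: a) t].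
  apply: measurable_setb; apply: measurable_spaced => //; exact: measurable_id.
(* The primitive - (1 - S - y)^(n+1) / (n+1)! in terms of divided powers. *)
pose q := (- 1) ^+ n.+1 * - 1 *: ((n.+1`!)%:R^-1 *: (('X - (1 - S)%:P) ^+ n.+1)).
have sliceE y : 0 <= y -> cube n [set t | [set t : n.+1.-tuple R | spaced x (a0 :: a) t] (consr (y, t))]
    = (if (x + a0 < y) && (y + S < 1) then (1 - (y + S)) ^+ n / (n`!)%:R else 0)%:E.
  move=> y0; have [xy|xy] /= := boolP (x + a0 < y).
    rewrite -(IH _ y sa a_ge0 y0); congr (cube n _).
    by apply/seteqP; split => t /=; rewrite xy.
  rewrite (_ : [set _ | _] = set0) ?measure0//.
  by apply/seteqP; split => t //=; rewrite (negbTE xy).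
have [xS|xS] := ltP (x + (a0 + S)) 1.
  rewrite (@cube_slice _ _ _ q (x + a0) (1 - S)) //.
  - congr (_%:E); rewrite /q !hornerE subrr expr0n /=.
    rewrite (_ : x + a0 - (1 - S) = - (1 - (x + a0 + S))); last by ring.
    rewrite [(- (1 - _)) ^+ _]exprNn.
    have : ((-1) ^+ n.+1 * (-1) ^+ n.+1 = 1 :> R) by rewrite -exprMn mulrN1 opprK expr1n.
    by move: ((-1) ^+ n.+1 : R) => e e2; rewrite -[RHS]mul1r -[X in _ = X * _]e2; ring.
  - by rewrite addr_ge0.
  - lra.
  - lra.
  - move=> y /andP[xy yS]; rewrite sliceE; last by lra.
    rewrite xy ifT; last by rewrite /=; lra.
    congr (_%:E); rewrite /q derivZ deriv_exp_div !hornerE.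
    rewrite (_ : y - (1 - S) = - (1 - (y + S))); last by ring.
    rewrite [(- (1 - _)) ^+ _]exprNn exprS.
    have : ((-1) ^+ n * (-1) ^+ n = 1 :> R) by rewrite -exprMn mulrN1 opprK expr1n.
    by move: ((-1) ^+ n : R) => e e2; rewrite -[LHS]mul1r -[X in X * _ = _]e2 /=; ring.
  - move=> y /andP[y0 y1] yn; rewrite sliceE// ifF//.
    by apply/negP => /andP[? ?]; move/negP: yn; apply; lra.
rewrite (@cube_slice _ _ _ 0 0 0) ?subrr//.
- by move=> y /andP[/lt_trans H /H]; rewrite ltxx.
- move=> y /andP[y0 y1] _; rewrite sliceE// ifF//.
  apply/negP => /andP[? ?].
  have : 1 < 1 :> R by lra.
  by rewrite ltxx.
Qed.

Fixpoint descending (u l : R) (s : seq R) : bool :=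
  if s is v :: s' then (v < u) && descending v l s' else l < u.

Lemma measurable_descending d (T : measurableType d) n (u l : T -> R) (g : T -> n.-tuple R) :
  measurable_fun setT u -> measurable_fun setT l -> measurable_fun setT g ->
  measurable_fun setT (fun w => descending (u w) (l w) (g w)).
Proof.
elim: n u g => [|n IH] u g mu ml mg.
  under eq_fun do rewrite (tuple0 (g _)) /=.
  exact: measurable_fun_ltr.
under eq_fun do rewrite (tuple_eta (g _)) /=.
apply: measurable_and.
  by apply: measurable_fun_ltr => //; exact: measurable_tuple_head.
apply: (IH _ (fun w => [tuple of behead (g w)] : n.-tuple R)) => //.
  exact: measurable_tuple_head.
exact: measurable_tuple_behead.
Qed.

(** The points form a simplex of side u - l. *)
Lemma cube_descending n (u l : R) : 0 <= l -> u <= 1 ->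
  cube n [set t : n.-tuple R | descending u l t] =
  (if l < u then (u - l) ^+ n / (n`!)%:R else 0)%:E.
Proof.
elim: n u => [|n IH] u l0 u1.
  rewrite (@cube0E _ _ (l < u))//.
  by case: ifP => _ //; rewrite expr0 fact0 divr1.
have mA : measurable [set t : n.+1.-tuple R | descending u l t].
  by apply: measurable_setb; apply: measurable_descending => //; exact: measurable_id.
pose q := (n.+1`!)%:R^-1 *: (('X - l%:P) ^+ n.+1).
have sliceE v : v <= 1 -> cube n [set t | [set t : n.+1.-tuple R | descending u l t] (consr (v, t))]
    = (if (v < u) && (l < v) then (v - l) ^+ n / (n`!)%:R else 0)%:E.
  move=> v1; have [vu|vu] /= := boolP (v < u).
    rewrite -(IH v)//; congr (cube n _).
    by apply/seteqP; split => t /=; rewrite vu.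
  rewrite (_ : [set _ | _] = set0) ?measure0//.
  by apply/seteqP; split => t //=; rewrite (negbTE vu).
have [lu|lu] := ltP l u.
  rewrite (@cube_slice _ _ _ q l u) //.
  - by rewrite /q !hornerE subrr expr0n /= mulr0 subr0 mulrC.
  - exact: ltW.
  - move=> v /andP[lv vu]; rewrite sliceE; last by lra.
    by rewrite lv vu /= /q deriv_exp_div !hornerE mulrC.
  - move=> v /andP[v0 v1] vn; rewrite sliceE// ifF//.
    by apply/negP => /andP[? ?]; move/negP: vn; apply; lra.
rewrite (@cube_slice _ _ _ 0 0 0) ?subrr//.
- by move=> y /andP[/lt_trans H /H]; rewrite ltxx.
- move=> v /andP[v0 v1] _; rewrite sliceE// ifF//.
  apply/negP => /andP[? ?].
  have : 1 < 1 :> R by lra.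
  by rewrite ltxx.
Qed.

(** The argument p accumulates the product of the first j points, which becomes
    the lower bound for the remaining ones; it is a parameter so that a slice
    of such a set is a set of the same kind.  The first j points are required
    to be positive since this does not follow from the other conditions. *)
Fixpoint descending_prod (j : nat) (p u : R) (s : seq R) : bool :=
  match j, s with
  | j'.+1, v :: s' => (0 < v < u) && descending_prod j' (p * v) v s'
  | _, _ => descending u p s
  end.

Lemma measurable_descending_prod d (T : measurableType d) n j (p u : T -> R) (g : T -> n.-tuple R) :
  measurable_fun setT p -> measurable_fun setT u -> measurable_fun setT g ->
  measurable_fun setT (fun w => descending_prod j (p w) (u w) (g w)).
Proof.
elim: j n p u g => [|j IH] [|n] p u g mp mu mg; try exact: measurable_descending.
  have := measurable_descending mu mp mg.
  by under eq_fun do rewrite (tuple0 (g _)) /=; under [X in _ -> measurable_fun _ X]eq_fun do rewrite (tuple0 (g _)) /=.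
under eq_fun do rewrite (tuple_eta (g _)) /=.
apply: measurable_and.
  by apply: measurable_and; apply: measurable_fun_ltr => //;
    exact: measurable_tuple_head.
apply: (IH _ (fun w => p w * thead (g w)) _
             (fun w => [tuple of behead (g w)] : n.-tuple R)).
- by apply: measurable_funM => //; exact: measurable_tuple_head.
- exact: measurable_tuple_head.
- exact: measurable_tuple_behead.
Qed.

(** The factors N + 1 + r (l + 1) are the exponents met in j successive
    integrations of the l-th term of the binomial expansion of (u - p)^N. *)
Definition descending_vol (N j : nat) (p u : R) : R :=
  (N`!)%:R^-1 * \sum_(l < N.+1)
    'C(N, l)%:R * (- p) ^+ l * u ^+ (N - l + j * l.+1) *
    (\prod_(r < j) (N.+1 + r * l.+1)%:R)^-1.

(** The l-th term of the volume of the slice at v is a multiple of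
    (p v)^l v^(N - l + j (l + 1)) = p^l v^(N + j (l + 1)), whose primitive
    produces the new factor N + 1 + j (l + 1) in the denominator. *)
Lemma cube_descending_prod (N j : nat) (p u : R) : (0 < N)%N ->
  0 <= p -> p <= u -> u <= 1 ->
  cube (j + N) [set t : (j + N).-tuple R | descending_prod j p u t] =
  (descending_vol N j p u)%:E.
Proof.
move=> N0; elim: j p u => [|j IH] p u p0 pu u1.
  rewrite /descending_vol (eq_bigr (fun l : 'I_N.+1 => u ^+ (N - l) * (- p) ^+ l *+ 'C(N, l))); last first.
    move=> l _; rewrite big_ord0 invr1 mulr1 mul0n addn0.
    by rewrite -mulrA [_ ^+ l * _]mulrC mulr_natl.
  rewrite -exprDn.
  rewrite (_ : [set _ | _] = [set t : N.-tuple R | descending u p t]); last first.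
    by apply/seteqP; split => t /=; case: (tval t).
  rewrite cube_descending//; move: pu; rewrite le_eqVlt => /predU1P[->|->].
    by rewrite ltxx subrr expr0n -[_ == _]negbK -lt0n N0 mulr0.
  by rewrite mulrC.
have mA : measurable [set t : (j.+1 + N).-tuple R | descending_prod j.+1 p u t].
  by apply: measurable_setb; apply: measurable_descending_prod => //; exact: measurable_id.
pose a (l : 'I_N.+1) : R := 'C(N, l)%:R * (- p) ^+ l *
    (\prod_(r < j.+1) (N.+1 + r * l.+1)%:R)^-1.
pose q : {poly R} := (N`!)%:R^-1 *: \sum_(l < N.+1) a l *: 'X^(N.+1 + j * l.+1).
have qE x : q.[x] = descending_vol N j.+1 p x.
  rewrite /q /descending_vol hornerZ horner_sum; congr (_ * _).
  apply: eq_bigr => l _; rewrite hornerZ hornerXn /a mulrAC; congr (_ * _ ^+ _ * _).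
  by rewrite mulSn addnA [(N - l + _)%N]addnS subnK// -ltnS.
have q0 : q.[0] = 0.
  rewrite /q hornerZ horner_sum big1 ?mulr0// => l _.
  by rewrite hornerZ hornerXn expr0n addSn mulr0.
have dq v : q^`().[v] = descending_vol N j (p * v) v.
  rewrite /q derivZ hornerZ /descending_vol; congr (_ * _).
  rewrite raddf_sum horner_sum; apply: eq_bigr => l _ /=.
  rewrite derivZ derivXn hornerZ hornerMn hornerXn /= addSn /=.
  rewrite /a big_ord_recr /= invfM -mulNr exprMn.
  have le : (l <= N)%N by rewrite -ltnS.
  have -> : v ^+ (N + j * l.+1) = v ^+ l * v ^+ (N - l + j * l.+1).
    by rewrite -exprD addnA subnKC.
  rewrite -addSn -[(_ ^+ l * _) *+ _]mulr_natl.
  have : (N.+1 + j * l.+1)%:R != 0 :> R by rewrite pnatr_eq0.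
  move: (N.+1 + j * l.+1)%:R => e e0.
  move: (\prod_(i < j) _)^-1 => f.
  by field.
rewrite addSn (@cube_slice _ _ _ q 0 u) ?q0 ?subr0 ?qE//.
- exact: le_trans p0 pu.
- move=> v /andP[v0 vu]; rewrite dq -IH ?mulr_ge0//; last 3 first.
  + exact: ltW.
  + by rewrite ler_piMl ?(ltW v0)// (le_trans pu).
  + by rewrite (le_trans (ltW vu)).
  congr (cube _ _); apply/seteqP; split => t /=; by rewrite v0 vu.
- move=> v /andP[v0 v1] vn.
  rewrite (_ : [set _ | _] = set0) ?measure0//.
  apply/seteqP; split => t //= /andP[/andP[_ vu] _].
  by move/negP: vn; apply; rewrite v0 ltW.
Qed.

End ordered_points.

(** * The pieces of a broken stick *)

Section pieces.
Context {R : realType}.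

Lemma measurable_tuple_nth n j : measurable_fun setT (fun t : n.-tuple R => (tval t)`_j).
Proof.
have [jn|nj] := ltnP j n.
  rewrite (_ : (fun _ => _) = fun t : n.-tuple R => tnth t (Ordinal jn)).
    exact: measurable_tnth.
  by apply/funext => t; rewrite (tnth_nth 0).
rewrite (_ : (fun _ => _) = fun=> 0); first exact: measurable_cst.
by apply/funext => t; rewrite nth_default// size_tuple.
Qed.

Lemma sort_perm_tuple n (t : n.-tuple R) :
  exists s : 'S_n, sort <=%R t = perm_tuple s t.
Proof.
have /tuple_permP[s st] : perm_eq (sort <=%R t) t by rewrite perm_sort.
by exists s; rewrite st.
Qed.

Lemma perm_tuple_sort n (t : n.-tuple R) (s : 'S_n) :
  sorted <=%R (perm_tuple s t) -> sort <=%R t = perm_tuple s t.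
Proof.
move=> st; apply: (sorted_eq le_trans le_anti) => //.
  exact: (sort_sorted le_total).
rewrite perm_sort perm_sym; apply/tuple_permP; by exists s.
Qed.

Lemma measurable_sorted_le n : measurable [set t : n.-tuple R | sorted <=%R t].
Proof.
rewrite (_ : [set _ | _] = \bigcap_(i in [set: 'I_n]) \bigcap_(j in [set j : 'I_n | (i < j)%N])
   [set t : n.-tuple R | tnth t i <= tnth t j]).
  apply: fin_bigcap_measurable; first exact: finite_finset.
  move=> i _; apply: fin_bigcap_measurable; first exact: finite_finset.
  move=> j _; apply: measurable_setb; apply: measurable_fun_ler; exact: measurable_tnth.
apply/seteqP; split => t /=.
  move=> st i _ j /= ij; rewrite !(tnth_nth 0).
  by apply: (sorted_ltn_nth le_trans 0 st) => //; rewrite inE size_tuple.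
move=> H; apply/(sortedP 0) => i; rewrite size_tuple => ilt.
have := H (Ordinal (ltnW ilt)) I (Ordinal ilt) (ltnSn _).
by rewrite /= !(tnth_nth 0).
Qed.

(** Finitely many measurable conditions tell which permutation sorts a tuple, and
    on each of the corresponding sets the j-th smallest entry is a coordinate. *)
Lemma measurable_nth_sort n j :
  measurable_fun setT (fun t : n.-tuple R => (sort <=%R (tval t))`_j).
Proof.
move=> _ B mB; rewrite setTI.
rewrite (_ : _ @^-1` _ = \bigcup_(s in [set: 'S_n])
  (perm_tuple s @^-1` ([set t : n.-tuple R | sorted <=%R t] `&`
    ((fun t : n.-tuple R => (tval t)`_j) @^-1` B)))).
  apply: fin_bigcup_measurable; first exact: finite_finset.
  move=> s _; rewrite -[X in measurable X]setTI; apply: measurable_perm_tuple => //.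
  apply: measurableI; first exact: measurable_sorted_le.
  by rewrite -[X in measurable X]setTI; exact: measurable_tuple_nth.
apply/seteqP; split => t /=.
  have [s st] := sort_perm_tuple t.
  by rewrite st => Bt; exists s => //; split => //=; rewrite -st; exact: (sort_sorted le_total).
by move=> [s _ [/perm_tuple_sort ->]].
Qed.

Definition pieces m (t : m.-tuple R) : 'I_m.+1 -> R := @piece R m.+1 (tnth t).

Lemma nodesE m (t : m.-tuple R) : nodes (tnth t) = 0 :: rcons (sort <=%R t) 1.
Proof. by rewrite /nodes map_tnth_enum. Qed.

Lemma measurable_pieces m i : measurable_fun setT (fun t : m.-tuple R => pieces t i).
Proof.
have H j : measurable_fun setT (fun t : m.-tuple R => (nodes (tnth t))`_j).
  under eq_fun do rewrite nodesE.
  case: j => [|j] /=; first exact: measurable_cst.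
  under eq_fun do rewrite nth_rcons size_sort size_tuple.
  case: (j < m)%N; first exact: measurable_nth_sort.
  by case: (j == m); exact: measurable_cst.
by apply: measurable_funB; exact: H.
Qed.

Lemma spacedP (x : R) (a s : seq R) :
  spaced x a s <->
  forall i, (i <= size s)%N -> a`_i < (rcons s 1)`_i - (x :: rcons s 1)`_i.
Proof.
elim: s x a => [|y s IH] x a /=.
  split=> [h [|]//= _|/(_ 0%N isT)] /=; rewrite ltrBrDl; first by rewrite nth0.
  by rewrite nth0.
split.
  move=> /andP[xy /IH H] [|i] /= il; first by rewrite ltrBrDl nth0.
  by have := H i il; rewrite nth_behead.
move=> H; apply/andP; split.
  by have := H 0%N isT; rewrite /= ltrBrDl nth0.
by apply/IH => i il; have := H i.+1 il; rewrite nth_behead.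
Qed.

Lemma spaced_path (x : R) (a s : seq R) : all (fun z => 0 <= z) a ->
  spaced x a s -> path <%R x s.
Proof.
elim: s x a => //= y s IH x a a0 /andP[xy /IH ->]; last first.
  by case: a a0 {xy} => //= ? ? /andP[].
rewrite andbT (le_lt_trans _ xy)// lerDl.
by case: a a0 {xy} => //= ? ? /andP[].
Qed.

(** Pieces do not depend on the order in which the stick is broken: gaps that
    exceed nonnegative bounds force the rearranged points to be increasing, so
    they are the sorted points. *)
Lemma pieces_gtP m (t : m.-tuple R) (a : 'I_m.+1 -> R) : (forall i, 0 <= a i) ->
  (forall i, a i < pieces t i) <->
  exists s : 'S_m, spaced 0 [seq a i | i <- enum 'I_m.+1] (perm_tuple s t).
Proof.
move=> a0; set al := [seq _ | _ <- _].
have ala i : (i < m.+1)%N -> al`_i = a (inord i).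
  move=> im; rewrite (nth_map ord0) ?size_enum_ord//; congr a.
  by apply: val_inj; rewrite /= nth_enum_ord// inordK.
have al0 : all (fun z => 0 <= z) al.
  by apply/allP => z /mapP[i _ ->].
have H : (forall i, a i < pieces t i) <-> spaced 0 al (sort <=%R t).
  rewrite spacedP size_sort size_tuple; split => H i.
    move=> im; have := H (inord i).
    by rewrite ala// /pieces /piece nodesE inordK.
  have := H i (ltn_ord i : i <= m)%N; rewrite ala// inord_val.
  by rewrite /pieces /piece nodesE.
rewrite H; split.
  by have [s ->] := sort_perm_tuple t; exists s.
move=> [s ss]; rewrite (@perm_tuple_sort _ t s)//.
by apply: sub_sorted (path_sorted (spaced_path al0 ss)) => x y; exact: ltW.
Qed.

(** The m! orders of the breaking points contribute equally, which cancels the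
    denominator of the volume of the simplex. *)
Lemma cube_pieces_gt m (a : 'I_m.+1 -> R) : (forall i, 0 <= a i) ->
  cube m [set t | forall i, a i < pieces t i] =
  (if \sum_i a i < 1 then (1 - \sum_i a i) ^+ m else 0)%:E.
Proof.
move=> a0; set al := [seq a i | i <- enum 'I_m.+1].
have al0 : all (fun z => 0 <= z) al.
  by apply/allP => z /mapP[i _ ->].
have sal : size al = m.+1 by rewrite size_map size_enum_ord.
pose D := [set t : m.-tuple R | spaced 0 al t].
rewrite (_ : [set _ | _] = \bigcup_(s in [set: 'S_m]) (perm_tuple s @^-1` D)).
  rewrite (@cube_sorted_perms _ _ <%R) //.
  - rewrite cube_spaced// ?(add0r (\sum_(z <- al) z)).
    rewrite (_ : \sum_(z <- al) z = \sum_i a i); last by rewrite big_map big_enum.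
    rewrite -EFinM; congr (_%:E); case: ifP => _; last by rewrite mulr0.
    by rewrite mulrCA mulfV ?mulr1// pnatr_eq0 -lt0n fact_gt0.
  - exact: lt_trans.
  - by apply: measurable_setb; apply: measurable_spaced => //; exact: measurable_id.
  - by move=> t /(spaced_path al0)/path_sorted.
apply/seteqP; split => t /=.
  by move/(pieces_gtP _ a0) => [s ss]; exists s.
by move=> [s _ ss]; apply/(pieces_gtP _ a0); exists s.
Qed.

End pieces.

(** * Forming polygons *)

Section polygons.
Context {R : realType}.

Definition some_not_polygon (k n : nat) (x : 'I_n -> R) : Prop :=
  exists A : {set 'I_n}, #|A| = k /\ ~ forms_polygon x A.

Lemma measurable_some_not_polygon d (T : measurableType d) k n (x : T -> 'I_n -> R) :
  (forall i, measurable_fun setT (fun w => x w i)) ->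
  measurable [set w | some_not_polygon k (x w)].
Proof.
move=> mx.
have -> : [set w | some_not_polygon k (x w)] =
  \bigcup_(A in [set A : {set 'I_n} | #|A| = k])
    ~` (\bigcup_(i in [set` A])
      ((\bigcap_(j in [set` A]) [set w | x w j <= x w i]) `&`
       [set w | x w i < \sum_(j in A | j != i) x w j])).
  apply/seteqP; split => w /=.
    move=> [A [Ak nA]]; exists A => //= -[i iA [imax isum]]; apply: nA.
    by exists i; split.
  move=> [A Ak nA]; exists A; split => // -[i [iA imax isum]]; apply: nA.
  by exists i => //; split.
apply: fin_bigcup_measurable; first exact: finite_finset.
move=> A _; apply: measurableC.
apply: fin_bigcup_measurable; first exact: finite_finset.
move=> i _; apply: measurableI.
  apply: fin_bigcap_measurable; first exact: finite_finset.
  by move=> j _; apply: measurable_setb; exact: measurable_fun_ler.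
apply: measurable_setb; apply: measurable_fun_ltr => //.
under eq_fun do rewrite big_mkcond /=.
apply: measurable_sum => j /=.
by case: ((j \in A) && (j != i)) => //; exact: mx.
Qed.

Lemma forms_polygon_perm n (x : 'I_n -> R) (s : 'S_n) (A : {set 'I_n}) :
  forms_polygon x (s @: A)%SET -> forms_polygon (x \o s) A.
Proof.
move=> [j [/finset.imsetP[i iA ->{j}] imax isum]].
exists i; split => //.
  by move=> j jA; apply: imax; apply: finset.imset_f.
rewrite /= (reindex_inj (@perm_inj _ s)) /= in isum.
apply: (lt_le_trans isum); rewrite le_eqVlt; apply/orP; left; apply/eqP.
apply: eq_bigl => j; rewrite finset.mem_imset; last exact: perm_inj.
by rewrite (inj_eq (@perm_inj _ s)).
Qed.

Lemma some_not_polygon_perm k n (x : 'I_n -> R) (s : 'S_n) :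
  some_not_polygon k (x \o s) <-> some_not_polygon k x.
Proof.
have H (y : 'I_n -> R) (r : 'S_n) : some_not_polygon k (y \o r) -> some_not_polygon k y.
  move=> [A [Ak nA]]; exists (r @: A)%SET; split.
    by rewrite finset.card_imset//; exact: perm_inj.
  by move=> ?; apply: nA; exact: forms_polygon_perm.
split; first exact: H.
move=> nx; apply: (H _ (s^-1)%g); rewrite (_ : _ \o _ = x)//.
by apply/funext => i /=; rewrite permKV.
Qed.

Lemma forms_polygon_scale n (x : 'I_n -> R) (g : R) (A : {set 'I_n}) : 0 < g ->
  forms_polygon (fun i => g * x i) A <-> forms_polygon x A.
Proof.
move=> g0; split=> -[i [iA imax isum]]; exists i; split => //.
- by move=> j /imax; rewrite ler_pM2l.
- by move: isum; rewrite -mulr_sumr ltr_pM2l.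
- by move=> j /imax; rewrite ler_pM2l.
- by rewrite -mulr_sumr ltr_pM2l.
Qed.

(** Whether a polygon can be formed depends on the ratios of the lengths only;
    this allows a random total length. *)
Lemma some_not_polygon_scale k n (x : 'I_n -> R) (g : R) : 0 < g ->
  some_not_polygon k (fun i => g * x i) <-> some_not_polygon k x.
Proof.
move=> g0; split=> -[A [Ak nA]]; exists A; split => // fA; apply: nA.
  exact/(forms_polygon_scale x A g0).
exact/(forms_polygon_scale x A g0).
Qed.

Lemma card_first n q : (q <= n)%N -> #|[set i : 'I_n | (i < q)%N]%SET| = q.
Proof.
move=> qn; rewrite -sum1_card (eq_bigl (fun i : 'I_n => (i < q)%N)).
  by rewrite -(big_ord_widen n (fun=> 1%N)) ?sum1_card ?card_ord.
by move=> i; rewrite finset.inE.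
Qed.

(** Induction on q, comparing the term of largest index b of B with the term of
    index q - 1: a set of q indices has an element that is at least q - 1. *)
Lemma sum_first_le n (x : 'I_n -> R) (q : nat) (B : {set 'I_n}) :
  (forall i j : 'I_n, (i <= j)%N -> x i <= x j) -> #|B| = q ->
  \sum_(i < n | (i < q)%N) x i <= \sum_(i in B) x i.
Proof.
move=> xm; elim: q B => [|q IH] B cB.
  by rewrite big_pred0// (finset.cards0_eq cB) big_set0.
have [b0 b0B] : exists b, b \in B by apply/finset.set0Pn; rewrite -card_gt0 cB.
pose b := [arg max_(i > b0 in B) (i : nat)].
have [bB bmax] : b \in B /\ forall i, i \in B -> (i <= b)%N.
  by rewrite /b; case: arg_maxnP.
have qb : (q <= b)%N.
  have /subset_leq_card : (B \subset [set i : 'I_n | (i < b.+1)%N])%SET.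
    by apply/fintype.subsetP => i /bmax; rewrite finset.inE.
  rewrite cB => /leq_trans; rewrite -ltnS; apply.
  by rewrite card_first.
have qn : (q < n)%N := leq_ltn_trans qb (ltn_ord b).
rewrite (bigD1 (Ordinal qn))//= (bigD1 b bB)/= lerD//; first exact: xm.
have -> : \sum_(j in B | j != b) x j = \sum_(j in (B :\ b)%SET) x j.
  by apply: eq_bigl => i; rewrite finset.in_setD1 andbC.
rewrite (eq_bigl (fun i : 'I_n => (i < q)%N)) => [|i].
  by apply: IH; move: cB; rewrite (finset.cardsD1 b) bB => -[].
by rewrite ltnS [RHS]ltn_neqAle -val_eqE /= andbC.
Qed.

(** If the inequality holds, the q shortest pieces and the longest one do not
    form a polygon; if it fails, the longest piece of a set of q + 1 pieces is
    at most the longest of all, and the other q pieces are together at least as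
    long as the q shortest by sum_first_le. *)
Lemma some_not_polygon_sorted n (x : 'I_n -> R) (m : 'I_n) (q : nat) :
  (forall i : 'I_n, (i <= m)%N) -> (0 < q <= m)%N ->
  (forall i j : 'I_n, (i <= j)%N -> x i <= x j) ->
  some_not_polygon q.+1 x <-> \sum_(i < n | (i < q)%N) x i <= x m.
Proof.
move=> mmax /andP[q0 qn] xm; split.
  move=> [A [cA nA]]; rewrite leNgt; apply/negP => lt; apply: nA.
  have [b0 b0A] : exists b, b \in A by apply/finset.set0Pn; rewrite -card_gt0 cA.
  pose b := [arg max_(i > b0 in A) (i : nat)].
  have [bA bmax] : b \in A /\ forall i, i \in A -> (i <= b)%N.
    by rewrite /b; case: arg_maxnP.
  exists b; split => //; first by move=> j /bmax; exact: xm.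
  apply: (@le_lt_trans _ _ (x m)); first exact: xm.
  apply: (lt_le_trans lt).
  have -> : \sum_(j in A | j != b) x j = \sum_(j in (A :\ b)%SET) x j.
    by apply: eq_bigl => i; rewrite finset.in_setD1 andbC.
  apply: sum_first_le => //.
  by move: cA; rewrite (finset.cardsD1 b) bA => -[].
move=> le.
pose F := [set i : 'I_n | (i < q)%N]%SET.
have mF : m \notin F by rewrite finset.inE -leqNgt.
exists (m |: F)%SET; split.
  rewrite finset.cardsU1 mF add1n; congr _.+1.
  by rewrite card_first// ltnW// (leq_ltn_trans qn).
move=> [i [iA imax isum]].
have im : x i = x m.
  apply/eqP; rewrite eq_le imax ?finset.setU11// andbT.
  exact: xm.
have tot : \sum_(j in (m |: F)%SET) x j = x m + \sum_(i < n | (i < q)%N) x i.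
  rewrite big_setU1//=; congr (_ + _); apply: eq_bigl => j; by rewrite finset.inE.
move: tot; rewrite (bigD1 i)//= im => /addrI tot.
by move: isum; rewrite tot im ltNge le.
Qed.

End polygons.

Section polygons_in_cube.
Context {R : realType}.

Lemma descendingE (u l : R) s : descending u l s = path >%R u s && (l < last u s).
Proof. by elim: s u => //= v s IH u; rewrite IH andbA. Qed.

Lemma descending_gt (u l : R) s : descending u l s -> l < u.
Proof. by elim: s u => //= v s IH u /andP[vu /IH /lt_trans]; apply. Qed.

Lemma descending_prodE (j : nat) (p u : R) s : (j <= size s)%N -> 0 < p ->
  descending_prod j p u s =
  descending u 0 s && (p * \prod_(v <- take j s) v < last u s).
Proof.
elim: j p u s => [|j IH] p u s.
  move=> _ p0; rewrite take0 big_nil mulr1.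
  have -> : descending_prod 0 p u s = descending u p s by case: s.
  rewrite !descendingE -andbA; congr andb; rewrite andbC.
  by apply/idP/andP => [ps|[]//]; split => //; exact: lt_trans ps.
case: s => //= v s js p0.
have [v0|v0] := boolP (0 < v); last first.
  rewrite /=; apply/esym/negbTE; apply: contra v0.
  by move=> /andP[/andP[_ /descending_gt]].
by rewrite /= IH ?mulr_gt0// big_cons mulrA andbA.
Qed.

Lemma sum_oppr_ln (s : seq R) : all (fun v => 0 < v) s ->
  \sum_(v <- s) - ln v = - ln (\prod_(v <- s) v).
Proof.
elim: s => [|v s IH] /=; first by rewrite !big_nil ln1 oppr0.
move=> /andP[v0 s0]; rewrite !big_cons IH// lnM ?posrE//; last first.
  by rewrite big_seq prodr_gt0// => w /(allP s0).
by rewrite opprD.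
Qed.

Lemma sum_tuple_take n (s : n.-tuple R) (f : R -> R) q : (q <= n)%N ->
  \sum_(v <- take q s) f v = \sum_(i < n | (i < q)%N) f (tnth s i).
Proof.
move=> qn; rewrite (eq_bigr (fun i : 'I_n => f (nth 0 s i))); last first.
  by move=> i _; rewrite (tnth_nth 0).
rewrite -(big_ord_widen n (fun i => f (nth 0 s i)))//.
rewrite (big_nth 0) size_take size_tuple.
have -> : (if (q < n)%N then q else n) = q.
  by case: ltnP => // nq; apply/eqP; rewrite eqn_leq nq qn.
by rewrite big_mkord; apply: eq_bigr => i _; rewrite nth_take.
Qed.

(** Taking logarithms reverses the order and turns the product of the q largest
    coordinates into the sum of the q smallest lengths. *)
Lemma descending_some_not_polygon n (q : nat) (s : n.-tuple R) :
  (0 < q < n)%N -> descending 1 0 s ->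
  some_not_polygon q.+1 (fun i => - ln (tnth s i)) <-> ~~ descending_prod q 1 1 s.
Proof.
case: n s => [|n] s; first by rewrite ltn0 andbF.
move=> /andP[q0 qn] ds.
rewrite descending_prodE ?size_tuple ?(ltnW qn)// ds mul1r /= -leNgt.
move: ds; rewrite descendingE => /andP[ps s0].
have lastE : last 1 s = tnth s ord_max.
  by rewrite (tnth_nth 1) /= -[n in nth _ _ n]/(n.+1.-1) -[in n.+1.-1](size_tuple s) nth_last; case: (tval s) (size_tuple s).
have ss : sorted >%R s := path_sorted ps.
have mono (i j : 'I_n.+1) : (i <= j)%N -> tnth s j <= tnth s i.
  rewrite leq_eqVlt => /predU1P[/val_inj ->//|ij].
  rewrite !(tnth_nth 0) ltW//.
  apply: (sorted_ltn_nth _ 0 ss) => //; rewrite ?inE ?size_tuple//.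
  by move=> ? ? ? /[swap]; exact: lt_trans.
have pos i : 0 < tnth s i.
  by rewrite (lt_le_trans s0)// lastE mono// -ltnS.
rewrite (@some_not_polygon_sorted _ _ _ ord_max)//.
- rewrite -(sum_tuple_take _ (fun v => - ln v)); last exact: ltnW.
  rewrite sum_oppr_ln; last first.
    by apply/allP => v /mem_take /tnthP[i ->].
  rewrite lerN2 lastE ler_ln ?posrE//.
  by rewrite big_seq prodr_gt0// => v /mem_take /tnthP[i ->].
- by move=> i; rewrite -ltnS.
- by rewrite q0 -ltnS.
- by move=> i j ij; rewrite lerN2 ler_ln ?posrE// mono.
Qed.

(** Almost every point of the cube has pairwise distinct coordinates in
    ]0, 1[.  This is obtained without discussing ties: the n! sets of points
    whose coordinates decrease after a given permutation are disjoint and have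
    volume 1/n! each. *)
Lemma cube_ln_some_not_polygon (q N : nat) : (0 < q)%N -> (0 < N)%N ->
  cube (q + N) [set u : (q + N).-tuple R |
                 some_not_polygon q.+1 (fun i => - ln (tnth u i))] =
  (1 - ((q + N)`!)%:R * descending_vol N q 1 1)%:E.
Proof.
move=> q0 N0; set n := (q + N)%N.
set Ev := [set _ | _].
have gT : transitive (>%R : rel R) by move=> ? ? ? /[swap]; exact: lt_trans.
have gI : irreflexive (>%R : rel R) by move=> ? /=; rewrite ltxx.
(* C D0 is the set of points with distinct coordinates between 0 and 1; on it
   the sorted coordinates decide, and C D1 is where all polygons exist. *)
pose D0 := [set t : n.-tuple R | descending 1 0 t].
pose D1 := [set t : n.-tuple R | descending_prod q 1 1 t].
pose C (D : set (n.-tuple R)) := \bigcup_(s in [set: 'S_n]) (perm_tuple s @^-1` D).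
have mD0 : measurable D0.
  by apply: measurable_setb; apply: measurable_descending => //; exact: measurable_id.
have mD1 : measurable D1.
  by apply: measurable_setb; apply: measurable_descending_prod => //; exact: measurable_id.
have D0s t : D0 t -> sorted >%R t.
  by rewrite /D0 /= descendingE => /andP[/path_sorted].
have D10 t : D1 t -> D0 t.
  rewrite /D1 /= descending_prodE ?size_tuple ?leq_addr// => /andP[]//.
have mC D : measurable D -> measurable (C D).
  move=> mD; apply: fin_bigcup_measurable; first exact: finite_finset.
  by move=> s _; rewrite -[X in measurable X]setTI; exact: measurable_perm_tuple.
have mEv : measurable Ev.
  apply: measurable_some_not_polygon => i; apply: measurable_funN.
  by apply: measurableT_comp => //; exact: measurable_tnth.
have PC0 : cube n (C D0) = 1%E.
  rewrite (cube_sorted_perms gI gT)// cube_descending// ltr01 subr0 expr1n.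
  by rewrite -EFinM mulrCA divff ?mulr1// pnatr_eq0 -lt0n fact_gt0.
have nEv : ~` Ev `&` C D0 = C D1.
  apply/seteqP; split => t /=.
    move=> [nE [s _ Ds]]; exists s => //=; rewrite /D1 /=; apply/negPn/negP => nd; apply: nE.
    rewrite /Ev /= -(some_not_polygon_perm _ _ s).
    have := (descending_some_not_polygon _ Ds).2 nd.
    rewrite (_ : (fun i => _) = (fun i => - ln (tnth t i)) \o s).
      by apply; rewrite q0 /n -[X in (X < _)%N]addn0 ltn_add2l.
    by apply/funext => i /=; rewrite tnth_mktuple.
  move=> [s _ Ds]; split; last by exists s => //; exact: D10.
  rewrite /Ev /= -(some_not_polygon_perm _ _ s).
  have -> : (fun i => - ln (tnth t i)) \o s = (fun i => - ln (tnth (perm_tuple s t) i)).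
    by apply/funext => i /=; rewrite tnth_mktuple.
  rewrite descending_some_not_polygon; [by rewrite Ds| |exact: D10].
  by rewrite q0 /n -[X in (X < _)%N]addn0 ltn_add2l.
have H : cube n (~` Ev) = ((n`!)%:R * descending_vol N q 1 1)%:E.
  rewrite -(probability_setI1 (measurableC mEv) (mC _ mD0) PC0) nEv.
  rewrite (cube_sorted_perms gI gT)//; last by move=> t /D10/D0s.
  by rewrite cube_descending_prod// EFinM.
have := probability_setC (cube n) (measurableC mEv).
by rewrite setCK H => ->.
Qed.

End polygons_in_cube.

(** * Mixing over a gamma distributed length *)

Section gamma_integral.
Context {R : realType}.

(** From exp x >= x^(n+1) / (n+1)! for x >= 0. *)
Lemma cvg_poly_expRN (p : {poly R}) : p.[x] * expR (- x) @[x --> +oo] --> (0 : R).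
Proof.
have Hm n : x ^+ n * expR (- x) @[x --> +oo] --> (0 : R).
  apply/cvgrPdist_le => e e0; near=> x.
  have x0 : 0 < x by near: x; apply: nbhs_pinfty_gt; exact: num_real.
  rewrite sub0r normrN ger0_norm ?mulr_ge0 ?expR_ge0 ?exprn_ge0 ?(ltW x0)//.
  rewrite expRN ler_pdivrMr ?expR_gt0//.
  have xn : (n.+1`!)%:R / e <= x by near: x; apply: nbhs_pinfty_ge; exact: num_real.
  have h : x ^+ n.+1 / (n.+1)`!%:R <= expR x.
    by have := expR_ge1Dxn n (ltW x0); lra.
  apply: (le_trans _ (ler_wpM2l (ltW e0) h)).
  have -> : e * (x ^+ n.+1 / n.+1`!%:R) = x ^+ n * (x * e / n.+1`!%:R).
    by rewrite exprS; ring.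
  rewrite -[leLHS]mulr1 ler_wpM2l ?exprn_ge0 ?(ltW x0)//.
  by rewrite ler_pdivlMr ?ltr0n ?fact_gt0// mul1r -ler_pdivrMr.
rewrite [X in X @ _ --> _](_ : _ = (fun x => \sum_(i < size p) p`_i * (x ^+ i * expR (- x)))); last first.
  apply/funext => x; rewrite horner_coef big_distrl/=.
  by apply: eq_bigr => i _; rewrite mulrA.
elim: (index_enum _) => [|i r IH].
  by under eq_fun do rewrite big_nil; exact: cvg_cst.
under eq_fun do rewrite big_cons.
have := cvgD (cvgMl_tmp (a := p`_i) (Hm i)) IH.
by rewrite mulr0 addr0; exact.
Unshelve. all: by end_near. Qed.

(** A primitive is - exp(-x) q(x), where q is the sum of the divided powers
    (X - a)^i / i! for i <= m: the difference of q and its derivative is the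
    term of index m. *)
Lemma integral_gamma (a : R) m :
  (\int[lebesgue_measure]_(x in `[a, +oo[) (((x - a) ^+ m / (m`!)%:R * expR (- x))%:E) =
   (expR (- a))%:E)%E.
Proof.
pose e n : {poly R} := (n`!)%:R^-1 *: ('X - a%:P) ^+ n.
pose q : {poly R} := \sum_(i < m.+1) e i.
have qa : q.[a] = 1.
  rewrite /q horner_sum big_ord_recl big1 ?addr0 => [|i _].
    by rewrite /e hornerZ expr0 hornerC fact0 invr1 mulr1.
  by rewrite /e hornerZ horner_exp !hornerE subrr expr0n /= mulr0.
have qE : q - q^`() = e m.
  rewrite /q raddf_sum [X in _ - X]big_ord_recl [X in X - _]big_ord_recr /=.
  have -> : (e (@ord0 m))^`() = 0.
    by rewrite /e expr0 derivZ -polyC1 derivC scaler0.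
  rewrite add0r.
  rewrite [X in _ - X](eq_bigr (fun i : 'I_m => e i)) => [|i _]; last exact: deriv_exp_div.
  by rewrite addrAC subrr add0r.
pose F (x : R) := - (q.[x] * expR (- x)).
have dF (x : R) : is_derive x 1 F ((x - a) ^+ m / (m`!)%:R * expR (- x)).
  have : is_derive x (1:R) (fun y : R => expR (- y)) (- expR (- x)).
    by apply: is_derive_eq; rewrite /GRing.scale /= mulrN1.
  move=> dE; rewrite /F.
  have dp := is_derive_poly q x.
  apply: (is_derive_eq (is_deriveN (is_deriveM dp dE))).
  have := congr1 (fun p : {poly R} => p.[x]) qE; rewrite /e !hornerE => {}qE.
  by rewrite [X in _ = X * _]mulrC -qE /GRing.scale /=; ring.
rewrite (@ge0_continuous_FTC2y _ _ F a 0).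
- by rewrite /F qa mul1r EFinN oppeK add0e.
- by move=> x ax; rewrite mulr_ge0 ?expR_ge0// divr_ge0 ?exprn_ge0 ?subr_ge0.
- rewrite (_ : (fun x => _) = (fun x => (e m).[x] * expR (- x))); last first.
    by apply/funext => y; rewrite /e !hornerE [X in _ = X * _]mulrC.
  apply: continuous_subspaceT => x; apply: cvgM; first exact: continuous_horner.
  apply: (@continuous_comp _ _ _ (fun x : R => - x) expR).
    exact: oppr_continuous.
  exact: continuous_expR.
- by rewrite /F -oppr0; apply: cvgN; exact: cvg_poly_expRN.
- by move=> x _; case: (dF x).
- have /derivable1_diffP/differentiable_continuous cF : derivable F a 1.
    by case: (dF a).
  exact: cvg_at_right_filter.
- by move=> x _; rewrite derive1E; case: (dF x).
Qed.

End gamma_integral.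

Section gamma_mixture.
Context d d' (T : measurableType d) (T' : measurableType d') (R : realType).
Context (P : probability T R) (m : nat) (K : R * T -> T')
  (mK : measurable_fun setT K).

Definition gamma_pdf (x : R) : R := x ^+ m / (m`!)%:R * expR (- x).

(** The law of K (g, t) for g gamma distributed and t of law P, independent. The
    measurability proof is an argument because the measure structure declared
    on this set function depends on it. *)
Definition gamma_mixture (mK : measurable_fun setT K) (A : set T') : \bar R :=
  (\int[lebesgue_measure]_(x in `[0%R, +oo[)
     ((gamma_pdf x)%:E * P [set t | A (K (x, t))]))%E.

Lemma gamma_pdf_ge0 x : 0 <= x -> 0 <= gamma_pdf x.
Proof. by move=> x0; rewrite mulr_ge0 ?expR_ge0// divr_ge0 ?exprn_ge0. Qed.

Lemma measurable_gamma_pdf : measurable_fun setT gamma_pdf.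
Proof.
apply: measurable_funM.
  by apply: measurable_funM => //; exact: measurable_funX.
by apply: measurableT_comp => //; exact: measurable_funN.
Qed.

Lemma measurable_section (A : set T') : measurable A ->
  measurable_fun setT (fun x : R => P [set t | A (K (x, t))]).
Proof.
move=> mA; have := @measurable_fun_xsection _ _ R T R P (K @^-1` A).
rewrite (_ : _ \o _ = (fun x : R => P [set t | A (K (x, t))])).
  by apply; rewrite -[X in measurable X]setTI; exact: mK.
apply/funext => x /=; congr (P _).
by apply/seteqP; split => t /=; rewrite /xsection /= inE.
Qed.

Lemma measurable_slice (A : set T') x : measurable A ->
  measurable [set t | A (K (x, t))].
Proof.
move=> mA; have := @measurable_xsection _ _ R T (K @^-1` A) x.
rewrite (_ : xsection _ _ = [set t | A (K (x, t))]).
  by apply; rewrite -[X in measurable X]setTI; exact: mK.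
by apply/seteqP; split => t /=; rewrite /xsection /= inE.
Qed.

Let nu := gamma_mixture mK.

Let integrand_ge0 A x : `[0, +oo[%classic x ->
  (0 <= (gamma_pdf x)%:E * P [set t | A (K (x, t))])%E.
Proof.
by rewrite /= in_itv/= andbT => x0; rewrite mule_ge0// lee_fin gamma_pdf_ge0.
Qed.

Let nu0 : nu set0 = 0%E.
Proof. by rewrite [LHS]integral0_eq// => x _; rewrite measure0 mule0. Qed.

Let nu_ge0 A : (0 <= nu A)%E.
Proof. by apply: integral_ge0 => x; exact: integrand_ge0. Qed.

Let nu_sigma_additive : semi_sigma_additive nu.
Proof.
move=> F mF tF mUF.
rewrite [X in _ --> X](_ : _ = \sum_(n <oo) nu (F n))%E.
  by apply/cvg_closeP; split; [exact: is_cvg_nneseries|rewrite closeE].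
rewrite -integral_nneseries//.
- apply: eq_integral => x; rewrite inE/= in_itv/= andbT => x0.
  rewrite nneseriesZl//.
  congr (_ * _)%E; apply/esym/cvg_lim => //=.
  rewrite (_ : [set t | _] = \bigcup_n [set t | F n (K (x, t))])//.
  apply: (measure_sigma_additive (fun i => measurable_slice x (mF i))).
  by move=> i j _ _ [t [Fi Fj]]; apply: (tF i j) => //; exists (K (x, t)).
- move=> n; apply: emeasurable_funM.
    by apply/measurable_EFinP/measurable_funTS; exact: measurable_gamma_pdf.
  by apply: measurable_funTS; exact: measurable_section.
- by move=> n x; exact: integrand_ge0.
Qed.

HB.instance Definition _ :=
  isMeasure.Build _ _ _ (gamma_mixture mK) nu0 nu_ge0 nu_sigma_additive.

Let nuT : gamma_mixture mK setT = 1%E.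
Proof.
transitivity ((expR (- (0 : R)))%:E); last by rewrite oppr0 expR0.
rewrite -(integral_gamma 0 m); apply: eq_integral => x _.
by rewrite probability_setT mule1 subr0.
Qed.

HB.instance Definition _ :=
  @Measure_isProbability.Build _ _ R (gamma_mixture mK) nuT.

End gamma_mixture.

Section stick.
Context {R : realType}.

Definition exp_pieces m (gt : R * m.-tuple R) : m.+1.-tuple R :=
  [tuple expR (- (gt.1 * pieces gt.2 i)) | i < m.+1].

Lemma measurable_exp_pieces m : measurable_fun setT (@exp_pieces m).
Proof.
apply/measurable_fun_tnthP => i.
rewrite (_ : _ \o _ = fun gt => expR (- (gt.1 * pieces gt.2 i))); last first.
  by apply/funext => gt /=; rewrite tnth_mktuple.
apply: measurableT_comp => //; apply: measurable_funN; apply: measurable_funM => //.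
exact: (measurableT_comp (measurable_pieces i) measurable_snd).
Qed.

(** Given the length x of the stick, the condition u_i < b_i says that the i-th
    piece of the stick of length 1 exceeds a_i / x, where a_i = - ln b_i.  This
    has probability (1 - s / x)_+^m, where s is the sum of the a_i, and the
    factor x^m of the gamma density turns it into (x - s)_+^m. *)
Lemma exp_pieces_law m A : measurable A ->
  gamma_mixture (cube m) m (@measurable_exp_pieces m) A = cube m.+1 A.
Proof.
apply: cube_of_orthants.
  rewrite -(probability_setT (gamma_mixture (cube m) m (@measurable_exp_pieces m))).
  apply: eq_integral => x _; congr (_ * cube m _)%E.
  by apply/seteqP; split => t //= _ i; rewrite tnth_mktuple expR_gt0.
move=> b b01.
rewrite /= /gamma_mixture.
pose a i := - ln (b i).
have a0 i : 0 <= a i.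
  by have /andP[b0 b1] := b01 i; rewrite /a oppr_ge0 ln_le0.
set s := \sum_i a i.
have s0 : 0 <= s by apply: sumr_ge0.
have -> : \prod_i b i = expR (- s).
  rewrite /s -sumrN expR_sum; apply: eq_bigr => i _.
  by rewrite /a opprK lnK// posrE; have /andP[] := b01 i.
rewrite -(integral_gamma s m).
have slice (x : R) : 0 < x ->
    cube m [set t | orthant b (exp_pieces (x, t))] =
    (if s < x then (1 - s / x) ^+ m else 0)%:E.
  move=> x0.
  have -> : (s < x) = (\sum_i a i / x < 1).
    by rewrite -mulr_suml ltr_pdivrMr// mul1r.
  have -> : s / x = \sum_i a i / x by rewrite -mulr_suml.
  rewrite -cube_pieces_gt => [|i]; last by rewrite divr_ge0// ltW.
  congr (cube m _); apply/seteqP; split => t /= H i; have := H i;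
    have /andP[b0 b1] := b01 i.
    rewrite tnth_mktuple /= -(lnK b0) ltr_expR ltrNl -/(a i).
    by rewrite ltr_pdivrMr// mulrC.
  move=> h; rewrite tnth_mktuple /= -(lnK b0) ltr_expR ltrNl -/(a i); move: h.
  by rewrite ltr_pdivrMr// mulrC.
(* A stick of length at most s cannot have all pieces that long. *)
transitivity (\int[lebesgue_measure]_(x in `]s, +oo[)
    (((x - s) ^+ m / (m`!)%:R * expR (- x))%:E))%E; last first.
  apply: integral_itv_obnd_cbnd; apply: measurable_funTS; apply/measurable_EFinP.
  apply: measurable_funM; last first.
    by apply: measurableT_comp => //; exact: measurable_funN.
  by apply: measurable_funM => //; apply: measurable_funX; exact: measurable_funB.
rewrite -integral_itv_obnd_cbnd; last first.
  apply: emeasurable_funM; apply: measurable_funTS.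
    by apply/measurable_EFinP; exact: measurable_gamma_pdf.
  apply: measurable_section; first exact: measurable_exp_pieces.
  exact: measurable_orthant.
rewrite [LHS]integral_mkcond [RHS]integral_mkcond; apply: eq_integral => x _.
rewrite !patchE !mem_setE !in_itv/= !andbT.
case: ifPn => [x0|]; last first.
  by rewrite -leNgt => x0; rewrite ifF//; apply/negbTE; rewrite -leNgt (le_trans x0).
rewrite slice//; case: ifPn => [sx|_]; last by rewrite mule0.
rewrite -EFinM /gamma_pdf; congr (_%:E).
rewrite mulrAC; congr (_ * _); rewrite mulrAC; congr (_ / _).
by rewrite -exprMn mulrBr mulr1 mulrCA mulfV ?mulr1// gt_eqF.
Qed.

(** By scale invariance the probability of the event does not depend on the
    length of the stick, so it equals its mean over the gamma distribution. *)
Lemma cube_pieces_some_not_polygon m k :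
  cube m [set t : m.-tuple R | some_not_polygon k (pieces t)] =
  cube m.+1 [set u : m.+1.-tuple R | some_not_polygon k (fun i => - ln (tnth u i))].
Proof.
have mE : measurable [set u : m.+1.-tuple R | some_not_polygon k (fun i => - ln (tnth u i))].
  apply: measurable_some_not_polygon => i; apply: measurable_funN.
  by apply: measurableT_comp => //; exact: measurable_tnth.
rewrite -exp_pieces_law//.
set p := cube m _.
transitivity (\int[lebesgue_measure]_(x in `[0%R, +oo[) ((gamma_pdf m x)%:E * p))%E.
  rewrite -[p]fineK ?fin_num_measure//; last first.
    by apply: measurable_some_not_polygon => i; exact: measurable_pieces.
  rewrite ge0_integralZr//.
  - transitivity (1 * (fine p)%:E)%E; first by rewrite mul1e.
    congr (_ * _)%E.
    transitivity ((expR (- (0 : R)))%:E); first by rewrite oppr0 expR0.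
    rewrite -(integral_gamma 0 m); apply: eq_integral => x _.
    by rewrite subr0.
  - apply/measurable_EFinP/measurable_funTS; exact: measurable_gamma_pdf.
  - by move=> x; rewrite /= in_itv/= andbT => x0; rewrite lee_fin gamma_pdf_ge0.
  - by rewrite lee_fin fine_ge0 /p ?measure_ge0.
rewrite -[LHS]integral_itv_obnd_cbnd; last first.
  apply: emeasurable_funM; last exact: measurable_cst.
  by apply/measurable_EFinP/measurable_funTS; exact: measurable_gamma_pdf.
rewrite -[RHS]integral_itv_obnd_cbnd; last first.
  apply: emeasurable_funM; apply: measurable_funTS.
    by apply/measurable_EFinP; exact: measurable_gamma_pdf.
  by apply: measurable_section => //; exact: measurable_exp_pieces.
apply: eq_integral => x; rewrite inE/= in_itv/= andbT => x0.
congr (_ * cube m _)%E.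
apply/funext => t /=.
rewrite (_ : (fun i => - ln (tnth (exp_pieces (x, t)) i)) = (fun i => x * pieces t i)).
  by apply/propext; rewrite some_not_polygon_scale.
by apply/funext => i; rewrite tnth_mktuple /= expRK opprK.
Qed.

(** * The formula *)

Lemma fact_prod_ord (q N : nat) :
  ((q + N)`! = N`! * \prod_(r < q) (N.+1 + r))%N.
Proof.
elim: q => [|q IH]; first by rewrite big_ord0 muln1.
rewrite addSn factS IH big_ord_recr /= mulnCA addSn [(q + N)%N]addnC.
by rewrite [X in (_ * X)%N]mulnC.
Qed.

(** The factor r = 0 is N + 1, and r corresponds to the index k - 1 - r of c,
    where k = q + 2. *)
Lemma prod_c (q N j : nat) :
  (\prod_(r < q.+1) (N.+1 + r * j.+2) =
   N.+1 * \prod_(1 <= r < q.+1) c q.+2 (q.+1 + N) r j)%N.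
Proof.
rewrite big_ord_recl mul0n addn0; congr muln.
rewrite big_add1 /= big_mkord (reindex_inj rev_ord_inj) /=.
apply: eq_bigr => i _; rewrite /c /bump /=.
have iq := ltn_ord i.
nia.
Qed.

Lemma descending_vol_formula (q N : nat) : (1 < q)%N -> (0 < N)%N ->
  1 - ((q + N)`!)%:R * descending_vol N q 1 1 =
  ((q + N)`!)%:R / (N.+1`!)%:R * \sum_(0 <= j < N)
     (-1) ^+ j * ('C(N, j + 1))%:R *
     (\prod_(1 <= r < q) (c q.+1 (q + N) r j)%:R)^-1 :> R.
Proof.
case: q => // q q1 N0; rewrite /descending_vol big_ord_recl /=.
rewrite bin0 expr0 expr1n !mul1r.
have fact_neq0 k : (k`!)%:R != 0 :> R by rewrite pnatr_eq0 -lt0n fact_gt0.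
have first : \prod_(r < q.+1) (N.+1 + r * 1)%:R = ((q.+1 + N)`!)%:R / (N`!)%:R :> R.
  rewrite fact_prod_ord natrM mulrAC mulfV// mul1r natr_prod.
  by apply: eq_bigr => r _; rewrite muln1.
rewrite first invf_div mulrA mulrDr mulrA.
rewrite [X in 1 - (X + _)](_ : _ = 1); last first.
  by rewrite divfK// divff.
rewrite opprD addrA subrr add0r big_mkord mulr_sumr mulr_sumr -sumrN.
apply: eq_bigr => j _.
rewrite /bump /= add1n addn1 expr1n mulr1.
rewrite -natr_prod prod_c natrM -natr_prod factS natrM !invfM exprS.
ring.
Qed.

End stick.

Theorem theorem2 (R : realType) (d : measure_display) (T : measurableType d)
    (P : probability T R) (k n : nat) (hk : (3 <= k)%N) (hkn : (k <= n)%N)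
    (X : 'I_n.-1 -> {RV P >-> R})
    (X_unif : forall i : 'I_n.-1, uniform01 (X i))
    (X_indep : mutually_independent X) :
  P [set w : T | exists A : {set 'I_n},
       #|A| = k /\ ~ forms_polygon (piece (fun i : 'I_n.-1 => X i w)) A] =
  ((n`!)%:R / ((n - k + 2)`!)%:R *
   \sum_(0 <= j < (n - k).+1)
     (-1) ^+ j * ('C(n - k + 1, j + 1))%:R *
     (\prod_(1 <= r < k.-1) (c k n r j)%:R)^-1)%:E.
Proof.
(* The q = k - 1 shortest pieces compete with the longest of the N = n - k + 1
   other ones. *)
case: k hk hkn => // q hq.
case: n X X_unif X_indep => // m X X_unif X_indep qm.
have [N [N0 mN]] : exists N, (0 < N)%N /\ m.+1 = (q + N)%N.
  by exists (m.+1 - q)%N; split; lia.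
have -> : (m.+1 - q.+1 + 2 = N.+1)%N by lia.
have -> : (m.+1 - q.+1 + 1 = N)%N by lia.
have -> : ((m.+1 - q.+1).+1 = N)%N by lia.
rewrite [in RHS]mN -descending_vol_formula//.
rewrite (_ : [set w | _] = [set w | some_not_polygon q.+1
                              (pieces [tuple X i w | i < m])]); last first.
  apply/funext => w /=; rewrite /some_not_polygon /pieces.
  by rewrite (_ : tnth _ = fun i => X i w)//; apply/funext => i; rewrite tnth_mktuple.
rewrite (law_independent_uniform X_unif X_indep (A := [set t | some_not_polygon q.+1 (pieces t)])); last first.
  by apply: measurable_some_not_polygon => i; exact: measurable_pieces.
rewrite cube_pieces_some_not_polygon mN.
by rewrite cube_ln_some_not_polygon// ltnW.
Qed.
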